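(* Let $n\ge 1$ and let $\underline{k}=(k_1,\ldots,k_n),\ \underline{m}=(m_1,\ldots,m_n)\in\mathbb{N}^n$ be such that for every $i\in\{1,\ldots,n\}$, $k_i\geq 5$ and $1\leq m_i\leq\sqrt{k_i}$. Then for every intersection-closed family $\mathcal{F}\subseteq 2^{[n]}$ with $|\mathcal{F}|\geq 2$, there is an $i\in\bigcup_{A\in\mathcal{F}}A$ such that \[\frac{\sum_{A\in\mathcal{F}:\,i\notin A}\ \prod_{j\in A}\frac{m_j}{k_j}}{\sum_{A\in\mathcal{F}}\ \prod_{j\in A}\frac{m_j}{k_j}}\geq\frac{1}{2}.\]
   Context: $\mathbb{N}$ denotes the positive integers, $[n]=\{1,\ldots,n\}$, and $2^{[n]}$ is the set of all subsets of $[n]$. A family $\mathcal{F}$ of sets is intersection-closed if $A\cap B\in\mathcal{F}$ for all $A,B\in\mathcal{F}$. An empty product equals $1$. *)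

(* Defs.v *)
From mathcomp Require Import all_boot all_order all_algebra.

Set Implicit Arguments.
Unset Strict Implicit.
Unset Printing Implicit Defensive.

Import GRing.Theory Num.Theory.
Local Open Scope ring_scope.

Definition intersection_closed (T : finType) (F : {set {set T}}) : Prop :=
  forall A B : {set T}, A \in F -> B \in F -> A :&: B \in F.

(* \prod_(j in A) m_j / k_j; the divisions are taken in R, not in nat. *)
Definition weight (R : rcfType) (n : nat) (k m : 'I_n -> nat) (A : {set 'I_n})
  : R := \prod_(j in A) ((m j)%:R / (k j)%:R).

(* Main.v *)
(* If every i occurring in F were absent from less than half of F in weight, draw
   A and B independently from the law P on F proportional to the weight. As A :&: B
   lies in F, Gibbs' inequality bounds the entropy H(A :&: B) by H(A) minus the
   expected gain of log-weight, which is \sum_i c_i mu_i (1 - mu_i) with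
   mu_i = P(i \in A) and c_i = ln (k_i / m_i) >= ln (5 / 2). In the other direction
   (Gilmer), reveal the coordinates one by one: the inequality
   h(x y) >= 7/10 (x h(y) + y h(x)) for the binary entropy h gives
   H(A :&: B) >= 7/5 \sum_i mu_i H(A_i | A_1, ..., A_(i-1)). The two bounds are
   incompatible when all mu_i > 1/2, because 5 ln (5 / 2) > 6 ln 2. *)
Require Import Defs.
From mathcomp Require Import all_boot all_order all_algebra.
From mathcomp Require Import zify ring lra.
From mathcomp Require Import reals topology normedtype derive realfun exp.
From mathcomp Require Import Rstruct.

Set Implicit Arguments.
Unset Strict Implicit.
Unset Printing Implicit Defensive.

Import Order.TTheory GRing.Theory Num.Theory.
Import numFieldNormedType.Exports.
Local Open Scope ring_scope.

(** * Logarithm inequalities from the mean value theorem *)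

Lemma mean_value (R : realType) (f f' : R -> R) (a b : R) : a < b ->
  (forall x, a <= x <= b -> is_derive x 1 f (f' x)) ->
  exists2 c, a < c < b & f b - f a = f' c * (b - a).
Proof.
move=> ab df.
have [x||c] := @MVT R f f' a b ab.
- by rewrite in_itv /= => /andP[/ltW ax /ltW xb]; apply: df; rewrite ax.
- apply: derivable_within_continuous => x; rewrite in_itv /= => /df dfx.
  exact: ex_derive.
by rewrite in_itv /= => cab ->; exists c.
Qed.

Lemma ln_le_subr1 (R : realType) (x : R) : 0 < x -> ln x <= x - 1.
Proof.
by move=> x0; rewrite -{1}[x](subrKC 1); apply: le_ln1Dx; lra.
Qed.

(** The difference of the two sides vanishes at 0 and has derivative [t - ln (1 + t) >= 0]. *)
Lemma ln1D_mul_le (R : realType) (x : R) : 0 <= x ->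
  (1 + x) * ln (1 + x) <= x + x ^+ 2 / 2.
Proof.
rewrite le_eqVlt => /predU1P[<-|x0]; first by rewrite addr0 ln1; lra.
pose f (t : R) := t + t ^+ 2 / 2 - (1 + t) * ln (1 + t).
have [c /andP[c0 cx]] : exists2 c, 0 < c < x &
    f x - f 0 = (c - ln (1 + c)) * (x - 0).
  apply: mean_value => // t /andP[t0 _].
  have dln : is_derive (1 + t) 1 (@ln R) (1 + t)^-1 by apply: is_derive1_ln; lra.
  apply: is_derive_eq; rewrite /GRing.scale /=.
  by field; lra.
have cln : 0 <= c - ln (1 + c) by have := @ln_le_subr1 R (1 + c); lra.
have := mulr_ge0 cln (ltW x0).
by rewrite /f subr0 !addr0 ln1; lra.
Qed.

(** Start of the Taylor series of [- ln (1 - x)]; the difference has derivative [t^2 / (1 - t)]. *)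
Lemma le_oppr_ln1B (R : realType) (x : R) : 0 <= x < 1 ->
  x + x ^+ 2 / 2 <= - ln (1 - x).
Proof.
move=> /andP[]; rewrite le_eqVlt => /predU1P[<-|x0] x1.
  by rewrite subr0 ln1; lra.
pose f (t : R) := - ln (1 - t) - (t + t ^+ 2 / 2).
have [c /andP[c0 cx]] : exists2 c, 0 < c < x &
    f x - f 0 = c ^+ 2 / (1 - c) * (x - 0).
  apply: mean_value => // t /andP[t0 tx].
  have dln : is_derive (1 - t) 1 (@ln R) (1 - t)^-1 by apply: is_derive1_ln; lra.
  apply: is_derive_eq; rewrite /GRing.scale /=.
  by field; lra.
have c1 : 0 <= c ^+ 2 / (1 - c) by rewrite divr_ge0 ?sqr_ge0//; lra.
have := mulr_ge0 c1 (ltW x0).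
by rewrite /f !subr0 ln1; lra.
Qed.

Lemma ln_le_tangent (R : realType) (x y : R) : 0 < x -> 0 < y ->
  ln y <= ln x + (y / x - 1).
Proof.
move=> x0 y0; rewrite -{1}[y](divfK (lt0r_neq0 x0)) lnM ?posrE ?divr_gt0//.
by rewrite addrC lerD2l; apply/ln_le_subr1/divr_gt0.
Qed.

(** Chord slopes from 0 of the convex function [- ln (1 - t)] increase. *)
Lemma oppr_ln1B_div_le (R : realType) (x y : R) : 0 < x -> x <= y -> y < 1 ->
  - ln (1 - x) / x <= - ln (1 - y) / y.
Proof.
move=> x0 xy y1.
have x1 : 0 < 1 - x by lra.
have lny : ln (1 - y) <= ln (1 - x) + ((1 - y) / (1 - x) - 1).
  by apply: ln_le_tangent; lra.
have ln1x : 0 <= ln (1 - x) + (1 / (1 - x) - 1).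
  by rewrite -(ln1 R); apply: ln_le_tangent; lra.
have y0 : 0 < y by lra.
rewrite ler_pdivlMr// mulrAC ler_pdivrMr// !mulNr lerN2.
have yx : 0 <= y - x by lra.
(* With weights [x] and [y - x] the rational terms of the two tangent bounds cancel. *)
have := lerD (ler_wpM2l (ltW x0) lny) (mulr_ge0 yx ln1x).
rewrite addr0 [X in _ -> X <= _]mulrC => /le_trans; apply.
by rewrite le_eqVlt; apply/orP; left; apply/eqP; field; lra.
Qed.

(** * The binary entropy function under products *)

(* [h x / x] where h is the binary entropy function. *)
Definition entropy_ratio (R : realType) (x : R) : R :=
  - ln x - (x^-1 - 1) * ln (1 - x).

Lemma is_derive_entropy_ratio (R : realType) (x : R) : 0 < x < 1 ->
  is_derive x 1 (@entropy_ratio R) (ln (1 - x) / x ^+ 2).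
Proof.
move=> /andP[x0 x1].
have dln : is_derive x 1 (@ln R) x^-1 by exact: is_derive1_ln.
have dln1 : is_derive (1 - x) 1 (@ln R) (1 - x)^-1 by apply: is_derive1_ln; lra.
have dinv := is_deriveV (lt0r_neq0 x0) (is_derive_id x 1).
rewrite /entropy_ratio; apply: is_derive_eq; rewrite /GRing.scale /=.
by field; lra.
Qed.

(** The derivative with respect to [ln x] is [ln (1 - x) / x], which decreases by
    [oppr_ln1B_div_le]; the right side is the tangent at [ln z]. *)
Lemma entropy_ratio_le_tangent (R : realType) (x z : R) :
  0 < x < 1 -> 0 < z < 1 ->
  entropy_ratio x <= entropy_ratio z + ln (1 - z) / z * (ln x - ln z).
Proof.
move=> /andP[x0 x1] /andP[z0 z1].
pose f (t : R) := ln (1 - z) / z * (ln t - ln z) - entropy_ratio t.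
pose f' (t : R) := (ln (1 - z) / z - ln (1 - t) / t) / t.
have df (t : R) : 0 < t < 1 -> is_derive t 1 f (f' t).
  move=> t01; have /andP[t0 t1] := t01.
  have dln : is_derive t 1 (@ln R) t^-1 by exact: is_derive1_ln.
  have dratio := is_derive_entropy_ratio t01.
  apply: is_derive_eq; rewrite /GRing.scale /= /f'.
  by field; lra.
suff : f z <= f x by rewrite /f subrr mulr0; lra.
rewrite -subr_ge0; case: (ltgtP z x) => [zx|xz|->]; last by rewrite subrr.
- have [t|c /andP[zc cx] ->] := @mean_value R f f' z x zx.
    by move=> /andP[zt tx]; apply: df; lra.
  apply: mulr_ge0; last by lra.
  apply: divr_ge0; last by lra.
  have := @oppr_ln1B_div_le R z c z0 (ltW zc); rewrite !mulNr; lra.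
- have [t|c /andP[xc cz]] := @mean_value R f f' x z xz.
    by move=> /andP[xt tz]; apply: df; lra.
  rewrite -opprB => /eqP; rewrite eqr_oppLR => /eqP ->.
  rewrite -mulrN; apply: mulr_le0; last by lra.
  apply: mulr_le0_ge0; last by rewrite invr_ge0; lra.
  have := @oppr_ln1B_div_le R c z (lt_trans x0 xc) (ltW cz); rewrite !mulNr; lra.
Qed.

(** In terms of h: [h(z^2) >= 7/5 z h(z)]. At [z^2 = 1 - z] both entropies agree, so the constant
    cannot exceed the golden ratio; 7/5 leaves room for polynomial bounds. *)
Lemma entropy_ratio_sqr_ge (R : realType) (z : R) : 0 < z < 1 ->
  7 / 5 * entropy_ratio z <= entropy_ratio (z ^+ 2).
Proof.
move=> /andP[z0 z1].
have lnz : 1 - z <= - ln z by have := ln_le_subr1 z0; lra.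
have ln1Bz : z + z ^+ 2 / 2 <= - ln (1 - z) by apply: le_oppr_ln1B; lra.
have ln1Dz : (1 + z) * ln (1 + z) <= z + z ^+ 2 / 2.
  by apply: ln1D_mul_le; lra.
have ln1Bz2 : ln (1 - z ^+ 2) = ln (1 - z) + ln (1 + z).
  by rewrite -lnM ?posrE; [congr ln; ring|lra|lra].
have lnz2 : ln (z ^+ 2) = ln z + ln z by rewrite expr2 lnM ?posrE.
rewrite /entropy_ratio ln1Bz2 lnz2 -subr_ge0 -(pmulr_rge0 _ (exprn_gt0 2 z0)).
(* Each logarithm now has a coefficient of known sign. Replacing the three by their polynomial
   bounds leaves [z^2 (1 - z)^2 / 5]. *)
have -> : z ^+ 2 * (- (ln z + ln z) - ((z ^+ 2)^-1 - 1)
    * (ln (1 - z) + ln (1 + z)) - 7 / 5 * (- ln z - (z^-1 - 1) * ln (1 - z)))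
  = 3 / 5 * z ^+ 2 * (- ln z) + (1 - 2 / 5 * z) * (1 - z) * (- ln (1 - z))
    - (1 - z) * ((1 + z) * ln (1 + z)).
  by field; lra.
have z2 : 0 <= 3 / 5 * z ^+ 2 by apply: mulr_ge0; [lra|exact: sqr_ge0].
have zz : 0 <= (1 - 2 / 5 * z) * (1 - z) by apply: mulr_ge0; lra.
have := ler_wpM2l z2 lnz; have := ler_wpM2l zz ln1Bz.
have z1' : 0 <= 1 - z by lra.
have := ler_wpM2l z1' ln1Dz.
have : 0 <= z ^+ 2 * (1 - z) ^+ 2 by apply: mulr_ge0; exact: sqr_ge0.
lra.
Qed.

(* [entropy_ratio] is concave as a function of [ln x], so both factors can be
   replaced by their geometric mean. *)
Lemma entropy_ratioM_ge (R : realType) (x y : R) : 0 < x < 1 -> 0 < y < 1 ->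
  7 / 10 * (entropy_ratio x + entropy_ratio y) <= entropy_ratio (x * y).
Proof.
move=> /andP[x0 x1] /andP[y0 y1]; set z := Num.sqrt (x * y).
have xy0 : 0 < x * y by exact: mulr_gt0.
have z2 : z ^+ 2 = x * y by rewrite sqr_sqrtr// ltW.
have z0 : 0 < z by rewrite sqrtr_gt0.
have z1 : z < 1.
  by rewrite -(@ltr_pXn2r _ 2)// ?nnegrE ?(ltW z0)// z2 expr1n; nra.
have lnz : ln x + ln y = ln z + ln z.
  by rewrite -!lnM ?posrE// -z2 expr2.
have := @entropy_ratio_le_tangent R x z; have := @entropy_ratio_le_tangent R y z.
have := @entropy_ratio_sqr_ge R z; rewrite z0 z1 x0 x1 y0 y1 z2.
move=> /(_ isT) H2 /(_ isT isT) Hy /(_ isT isT) Hx.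
(* As [ln z] is the mean of [ln x] and [ln y], the first-order terms of the two tangents cancel. *)
have cancel_ln (c : R) : c * (ln x - ln z) + c * (ln y - ln z) = 0.
  by rewrite -mulrDr (_ : _ + _ = 0) ?mulr0; lra.
have := cancel_ln (ln (1 - z) / z); lra.
Qed.

(** * Gibbs' inequality and the entropy of two masses *)

(** Tangent bound of [ln] at [p], times [p]. The implication excludes [q = 0 < p], where [ln 0]
    would be a default value. *)
Lemma gibbs_term (R : realType) (p q : R) : 0 <= p -> 0 <= q ->
  (q = 0 -> p = 0) -> p * (ln q - ln p) <= q - p.
Proof.
rewrite le_eqVlt => /predU1P[<-|p0]; first by rewrite mul0r subr0.
rewrite le_eqVlt => /predU1P[<- /(_ erefl)|q0 _]; first by lra.
have := ler_wpM2l (ltW p0) (ln_le_tangent p0 q0).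
by rewrite mulrDr mulrBr mulrCA mulfV ?lt0r_neq0//; lra.
Qed.

Definition eta (R : realType) (t : R) : R := - (t * ln t).

(* [(s + t) h(s / (s + t))] where h is the binary entropy function. *)
Definition bent (R : realType) (s t : R) : R := eta s + eta t - eta (s + t).

Lemma eta0 (R : realType) : eta 0 = 0 :> R.
Proof. by rewrite /eta mul0r oppr0. Qed.

Lemma etaM (R : realType) (x y : R) : 0 <= x -> 0 <= y ->
  eta (x * y) = x * eta y + y * eta x.
Proof.
rewrite le_eqVlt => /predU1P[<-|x0].
  by rewrite !(mul0r, eta0, mulr0, addr0).
rewrite le_eqVlt => /predU1P[<-|y0].
  by rewrite !(mul0r, eta0, mulr0, addr0).
by rewrite /eta lnM ?posrE//; ring.
Qed.

Lemma bentE (R : realType) (s t : R) :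
  bent s t = s * (ln (s + t) - ln s) + t * (ln (s + t) - ln t).
Proof. by rewrite /bent /eta; ring. Qed.

Lemma bentC (R : realType) (s t : R) : bent s t = bent t s.
Proof. by rewrite /bent [s + t]addrC [eta s + _]addrC. Qed.

Lemma bent0l (R : realType) (t : R) : bent 0 t = 0.
Proof. by rewrite /bent eta0 !add0r subrr. Qed.

Lemma bentM (R : realType) (c s t : R) : 0 <= c -> 0 <= s -> 0 <= t ->
  bent (c * s) (c * t) = c * bent s t.
Proof.
move=> c0 s0 t0; have st0 : 0 <= s + t by exact: addr_ge0.
by rewrite /bent -mulrDr !etaM//; ring.
Qed.

Lemma bent_ge0 (R : realType) (s t : R) : 0 <= s -> 0 <= t -> 0 <= bent s t.
Proof.
move=> s0 t0; rewrite bentE.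
have term (p q : R) : 0 <= p -> 0 <= q -> 0 <= p * (ln (p + q) - ln p).
  rewrite le_eqVlt => /predU1P[<- _|p0 q0]; first by rewrite mul0r.
  apply: mulr_ge0; first exact: ltW.
  by rewrite subr_ge0 ler_ln ?posrE//; lra.
by apply: addr_ge0; [|rewrite [s + t]addrC]; exact: term.
Qed.

(** Gibbs' inequality: the cross-entropy of [s], [t] against the proportions of [S], [T] is at least
    their entropy. *)
Lemma bent_le_cross (R : realType) (s t S T : R) :
  0 <= s -> 0 <= t -> 0 <= S -> 0 <= T -> (S = 0 -> s = 0) -> (T = 0 -> t = 0) ->
  bent s t <= s * (ln (S + T) - ln S) + t * (ln (S + T) - ln T).
Proof.
move=> s0 t0 S0 T0 Ss Tt; rewrite bentE.
have [st|st] := ltrP 0 (s + t); last first.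
  have [-> ->] : s = 0 /\ t = 0 by split; lra.
  by rewrite !mul0r.
have ST : 0 < S + T.
  rewrite lt_neqAle addr_ge0// andbT; apply/eqP => ST.
  have Seq0 : S = 0 by lra.
  have Teq0 : T = 0 by lra.
  by move: st; rewrite (Ss Seq0) (Tt Teq0) addr0 ltxx.
(* Rescaling [S], [T] to total mass [s + t] makes the right-hand sides sum to 0. *)
have term (p P : R) : 0 <= p -> 0 <= P -> (P = 0 -> p = 0) ->
    p * (ln (s + t) - ln p) - p * (ln (S + T) - ln P)
      <= P * ((s + t) / (S + T)) - p.
  have r0 : 0 < (s + t) / (S + T) by exact: divr_gt0.
  move=> p0 P0 Pp; apply: le_trans (gibbs_term p0 _ _); last first.
  - by move=> /eqP; rewrite mulf_eq0 (gt_eqF r0) orbF => /eqP.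
  - by apply: mulr_ge0 => //; exact: ltW.
  move: P0; rewrite le_eqVlt => /predU1P[/esym/Pp ->|P0].
    by rewrite !mul0r subrr.
  by rewrite lnM ?ln_div ?posrE//; lra.
have : S * ((s + t) / (S + T)) + T * ((s + t) / (S + T)) = s + t.
  by rewrite -mulrDl mulrC divfK// gt_eqF.
by have := term s S s0 S0 Ss; have := term t T t0 T0 Tt; lra.
Qed.

(** Both pairs are compared with the reference [(s + s', t + t')], against which their
    cross-entropies add up to the right side. *)
Lemma bent_superadditive (R : realType) (s t s' t' : R) :
  0 <= s -> 0 <= t -> 0 <= s' -> 0 <= t' ->
  bent s t + bent s' t' <= bent (s + s') (t + t').
Proof.
move=> s0 t0 s'0 t'0; rewrite [X in _ <= X]bentE.
have [S0 T0] : 0 <= s + s' /\ 0 <= t + t' by split; lra.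
have := @bent_le_cross _ s t _ _ s0 t0 S0 T0.
move=> /(_ (ltac:(lra)) (ltac:(lra))).
have := @bent_le_cross _ s' t' _ _ s'0 t'0 S0 T0.
move=> /(_ (ltac:(lra)) (ltac:(lra))).
lra.
Qed.

Lemma bent_le_ln2 (R : realType) (s t : R) : 0 <= s -> 0 <= t ->
  bent s t <= (s + t) * ln 2.
Proof.
move=> s0 t0; have := @bent_le_cross _ s t 1 1 s0 t0 ler01 ler01.
rewrite ln1 subr0 -mulrDl; apply => /eqP; by rewrite oner_eq0.
Qed.

Lemma bent_ratio (R : realType) (s t : R) : 0 < s -> 0 < t ->
  bent s t = s * entropy_ratio (s / (s + t)).
Proof.
move=> s0 t0; have st : 0 < s + t by exact: addr_gt0.
have -> : entropy_ratio (s / (s + t))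
    = - (ln s - ln (s + t)) - t / s * (ln t - ln (s + t)).
  rewrite /entropy_ratio (_ : 1 - _ = t / (s + t)); last by field; lra.
  by rewrite !ln_div ?posrE// invf_div; congr (_ - _ * _); field; lra.
by rewrite bentE; field; lra.
Qed.

(** Homogeneous form of [h(x y) >= 7/10 (x h(y) + y h(x))] with [x = s / (s + t)] and
    [y = u / (u + v)]. Zero masses come first, as [entropy_ratioM_ge] lives on the open interval. *)
Lemma bent_product_ge (R : realType) (s t u v : R) :
  0 <= s -> 0 <= t -> 0 <= u -> 0 <= v ->
  7 / 10 * (u * bent s t + s * bent u v)
    <= bent (s * u) (s * v + t * u + t * v).
Proof.
rewrite le_eqVlt => /predU1P[<- _ _ _|s0].
  by rewrite !mul0r !bent0l mulr0 addr0 mulr0.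
move=> t0; rewrite le_eqVlt => /predU1P[<- _|u0].
  by rewrite mul0r !mulr0 !bent0l mulr0 addr0 mulr0.
move: t0; rewrite le_eqVlt => /predU1P[<- v0|t0].
  rewrite !mul0r !addr0 bentM ?(ltW s0) ?(ltW u0)// [bent s 0]bentC bent0l.
  have := mulr_ge0 (ltW s0) (bent_ge0 (ltW u0) v0); lra.
rewrite le_eqVlt => /predU1P[<-|v0].
  rewrite !mulr0 add0r addr0 ![_ * u]mulrC bentM ?(ltW s0) ?(ltW u0) ?(ltW t0)//.
  rewrite [bent u 0]bentC bent0l.
  have := mulr_ge0 (ltW u0) (bent_ge0 (ltW s0) (ltW t0)); lra.
have [su sv tu tv] : [/\ 0 < s * u, 0 < s * v, 0 < t * u & 0 < t * v].
  by split; exact: mulr_gt0.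
rewrite !bent_ratio//; last by lra.
have -> : s * u / (s * u + (s * v + t * u + t * v))
    = s / (s + t) * (u / (u + v)) by field; lra.
have frac01 (p q : R) : 0 < p -> 0 < q -> 0 < p / (p + q) < 1.
  by move=> p0 q0; rewrite divr_gt0 ?ltr_pdivrMr//=; lra.
have := ler_wpM2l (ltW su)
  (entropy_ratioM_ge (frac01 s t s0 t0) (frac01 u v u0 v0)); lra.
Qed.

(** * Measures on the cube, their marginals and conditional entropies *)

(* Functions on [{0,1}^n] are represented by functions on [seq bool], of which
   only the values at sequences of size [n] matter; [f \o cons b] is the
   restriction to the face where the first coordinate is [b]. *)
Fixpoint csum (R : realType) (n : nat) (f : seq bool -> R) : R :=
  if n is n'.+1 then csum n' (f \o cons true) + csum n' (f \o cons false)
  else f [::].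

Fixpoint cmarg (R : realType) (n : nat) (f : seq bool -> R) (i : nat) : R :=
  match n, i with
  | 0, _ => 0
  | n'.+1, 0 => csum n' (f \o cons true)
  | n'.+1, i'.+1 => cmarg n' (f \o cons true) i' + cmarg n' (f \o cons false) i'
  end.

(* Conditional entropy of the [i]-th coordinate given the previous ones. *)
Fixpoint cent_at (R : realType) (n : nat) (f : seq bool -> R) (i : nat) : R :=
  match n, i with
  | 0, _ => 0
  | n'.+1, 0 => bent (csum n' (f \o cons true)) (csum n' (f \o cons false))
  | n'.+1, i'.+1 =>
      cent_at n' (f \o cons true) i' + cent_at n' (f \o cons false) i'
  end.

(** The chain rule serves as definition; [csum_eta] identifies it with the Shannon entropy when the
    total mass is 1. *)
Definition cent (R : realType) (n : nat) (f : seq bool -> R) : R :=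
  \sum_(i < n) cent_at n f i.

Definition bitmeet (s t : seq bool) : seq bool := [seq x.1 && x.2 | x <- zip s t].

(* The law of [bitmeet A B] for independent [A] and [B] of laws [f] and [g]. *)
Fixpoint cmeet (R : realType) (n : nat) (f g : seq bool -> R) (s : seq bool)
    : R :=
  match n, s with
  | 0, _ => f [::] * g [::]
  | n'.+1, true :: s' => cmeet n' (f \o cons true) (g \o cons true) s'
  | n'.+1, false :: s' => cmeet n' (f \o cons true) (g \o cons false) s'
      + cmeet n' (f \o cons false) (g \o cons true) s'
      + cmeet n' (f \o cons false) (g \o cons false) s'
  | _, [::] => 0
  end.

Lemma eq_csum (R : realType) n (f g : seq bool -> R) :
  (forall s, size s = n -> f s = g s) -> csum n f = csum n g.
Proof.
elim: n f g => [|n IHn] f g fg /=; first exact: fg.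
by congr (_ + _); apply: IHn => s sn; apply: fg; rewrite /= sn.
Qed.

Lemma le_csum (R : realType) n (f g : seq bool -> R) :
  (forall s, size s = n -> f s <= g s) -> csum n f <= csum n g.
Proof.
elim: n f g => [|n IHn] f g fg /=; first exact: fg.
by apply: lerD; apply: IHn => s sn; apply: fg; rewrite /= sn.
Qed.

Lemma csumD (R : realType) n (f g : seq bool -> R) :
  csum n (fun s => f s + g s) = csum n f + csum n g.
Proof.
elim: n f g => [//|n IHn] f g /=.
have IH b : csum n ((fun s => f s + g s) \o cons b) = _ :=
  IHn (f \o cons b) (g \o cons b).
by rewrite !IH addrACA.
Qed.

Lemma csumZ (R : realType) n (a : R) (f : seq bool -> R) :
  csum n (fun s => a * f s) = a * csum n f.
Proof.
elim: n f => [//|n IHn] f /=.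
by rewrite mulrDr -!IHn; congr (_ + _); apply: eq_csum.
Qed.

Lemma csum_sum (R : realType) n (I : finType) (f : I -> seq bool -> R) :
  csum n (fun s => \sum_i f i s) = \sum_i csum n (f i).
Proof.
elim: n f => [//|n IHn] f /=.
by rewrite big_split /= -!IHn.
Qed.

Lemma csum_ge0 (R : realType) n (f : seq bool -> R) :
  (forall s, 0 <= f s) -> 0 <= csum n f.
Proof.
by elim: n f => [|n IHn] f f0 //=; apply: addr_ge0; apply: IHn => s; exact: f0.
Qed.

Lemma cmargE (R : realType) n (f : seq bool -> R) i :
  cmarg n f i = csum n (fun s => (nth false s i)%:R * f s).
Proof.
elim: n f i => [|n IHn] f [|i] /=; rewrite ?mul0r//.
- rewrite -[LHS]addr0; congr (_ + _).
    by apply: eq_csum => s; rewrite /= mul1r.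
  by rewrite csumZ mul0r.
- by rewrite !IHn.
Qed.

Lemma cmarg_bounds (R : realType) n (f : seq bool -> R) i :
  (forall s, 0 <= f s) -> 0 <= cmarg n f i <= csum n f.
Proof.
move=> f0; rewrite cmargE csum_ge0 => [|s]; last by rewrite mulr_ge0.
by apply: le_csum => s _; case: nth; rewrite ?mul1r ?mul0r.
Qed.

Lemma cent_at_ge0 (R : realType) n (f : seq bool -> R) i :
  (forall s, 0 <= f s) -> 0 <= cent_at n f i.
Proof.
elim: n f i => [|n IHn] f [|i] f0 //=.
  by apply: bent_ge0; apply: csum_ge0 => s; exact: f0.
by apply: addr_ge0; apply: IHn => s; exact: f0.
Qed.

Lemma cent_at_superadditive (R : realType) n (f g : seq bool -> R) i :
  (forall s, 0 <= f s) -> (forall s, 0 <= g s) ->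
  cent_at n f i + cent_at n g i <= cent_at n (fun s => f s + g s) i.
Proof.
elim: n f g i => [|n IHn] f g [|i] f0 g0 /=; rewrite ?addr0//.
  rewrite !csumD; apply: bent_superadditive;
  by apply: csum_ge0 => s; [exact: f0 || exact: g0].
rewrite addrACA; apply: lerD; apply: IHn => s;
  by [exact: f0 | exact: g0].
Qed.

Lemma cent_superadditive (R : realType) n (f g : seq bool -> R) :
  (forall s, 0 <= f s) -> (forall s, 0 <= g s) ->
  cent n f + cent n g <= cent n (fun s => f s + g s).
Proof.
move=> f0 g0; rewrite /cent -big_split /=.
by apply: ler_sum => i _; exact: cent_at_superadditive.
Qed.

(** Conditioning does not increase entropy: superadditivity merges the contributions of the two
    faces. *)
Lemma cent_at_le_bent (R : realType) n (f : seq bool -> R) i :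
  (forall s, 0 <= f s) ->
  cent_at n f i <= bent (cmarg n f i) (csum n f - cmarg n f i).
Proof.
elim: n f i => [|n IHn] f [|i] f0 /=.
- by rewrite bent0l.
- by rewrite bent0l.
- by rewrite addrC addKr.
have fb b : forall s, 0 <= (f \o cons b) s by move=> s; exact: f0.
apply: le_trans (lerD (IHn _ i (fb true)) (IHn _ i (fb false))) _.
have /andP[m1 c1] := cmarg_bounds n i (fb true).
have /andP[m0 c0] := cmarg_bounds n i (fb false).
rewrite opprD [X in _ <= bent _ X]addrACA.
by apply: bent_superadditive => //; rewrite subr_ge0.
Qed.

Lemma centS (R : realType) n (f : seq bool -> R) :
  cent n.+1 f = bent (csum n (f \o cons true)) (csum n (f \o cons false))
    + (cent n (f \o cons true) + cent n (f \o cons false)).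
Proof. by rewrite /cent big_ord_recl /= big_split. Qed.

Lemma csum_eta (R : realType) n (f : seq bool -> R) :
  csum n (fun s => eta (f s)) = eta (csum n f) + cent n f.
Proof.
elim: n f => [|n IHn] f; first by rewrite /cent big_ord0 addr0.
by rewrite centS /= !IHn /bent; ring.
Qed.

(** * The entropy of the meet of independent samples *)

(** Integration against the law of the meet; [phi = 1] gives its mass, a coordinate function its
    marginal. *)
Lemma csum_cmeet (R : realType) n (f g phi : seq bool -> R) :
  csum n (fun s => phi s * cmeet n f g s)
    = csum n (fun s => csum n (fun t => phi (bitmeet s t) * (f s * g t))).
Proof.
elim: n f g phi => [//|n IHn] f g phi.
have IH a b c := IHn (f \o cons a) (g \o cons b) (phi \o cons c).
transitivity (csum n (fun s => phi (true :: s)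
      * cmeet n (f \o cons true) (g \o cons true) s)
    + (csum n (fun s => phi (false :: s)
          * cmeet n (f \o cons true) (g \o cons false) s)
      + csum n (fun s => phi (false :: s)
          * cmeet n (f \o cons false) (g \o cons true) s)
      + csum n (fun s => phi (false :: s)
          * cmeet n (f \o cons false) (g \o cons false) s))).
  rewrite /=.
  congr (_ + _); rewrite -!csumD.
  by apply: eq_csum => s _ /=; rewrite !mulrDr.
rewrite (IH true true true) (IH true false false) (IH false true false).
by rewrite (IH false false false) /= !csumD /= !addrA.
Qed.

Lemma csum_csumM (R : realType) n (f g : seq bool -> R) :
  csum n (fun s => csum n (fun t => f s * g t)) = csum n f * csum n g.
Proof.
rewrite mulrC -csumZ; apply: eq_csum => s _; by rewrite csumZ mulrC.
Qed.

Lemma csum_cmeet1 (R : realType) n (f g : seq bool -> R) :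
  csum n (cmeet n f g) = csum n f * csum n g.
Proof.
have := csum_cmeet n f g (fun=> 1); rewrite -csum_csumM => E.
transitivity (csum n (fun s => 1 * cmeet n f g s)).
  by apply: eq_csum => s _; rewrite mul1r.
by rewrite E; apply: eq_csum => s _; apply: eq_csum => t _; rewrite mul1r.
Qed.

Lemma nth_meet s t i : size s = size t ->
  nth false (bitmeet s t) i = nth false s i && nth false t i.
Proof.
by elim: s t i => [|a s IHs] [|b t] [|i] //= [st]; exact: IHs.
Qed.

Lemma cmarg_cmeet (R : realType) n (f g : seq bool -> R) i :
  cmarg n (cmeet n f g) i = cmarg n f i * cmarg n g i.
Proof.
rewrite !cmargE csum_cmeet -csum_csumM.
apply: eq_csum => s sn; apply: eq_csum => t tn.
rewrite nth_meet ?sn ?tn// -mulnb natrM; ring.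
Qed.

Lemma cmeet_ge0 (R : realType) n (f g : seq bool -> R) s :
  (forall s, 0 <= f s) -> (forall s, 0 <= g s) -> 0 <= cmeet n f g s.
Proof.
elim: n f g s => [|n IHn] f g s f0 g0 /=; first exact: mulr_ge0.
have cons_ge0 b (h : seq bool -> R) :
    (forall s, 0 <= h s) -> forall s, 0 <= (h \o cons b) s.
  by move=> h0 t; exact: h0.
by case: s => [//|[] s]; rewrite ?addr_ge0 ?IHn//; exact: cons_ge0.
Qed.

(** For [f = g = h = P] this is absolute continuity of the meet with respect to [P]. The functions
    are kept apart because the induction restricts them to different faces. *)
Lemma cmeet_eq0 (R : realType) n (f g h : seq bool -> R) s :
  (forall s t, size s = n -> size t = n ->
     h (bitmeet s t) = 0 -> f s * g t = 0) ->
  size s = n -> h s = 0 -> cmeet n f g s = 0.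
Proof.
elim: n f g h s => [|n IHn] f g h [|b s] // fgh.
  by move=> _; exact: (fgh [::] [::]).
move=> [sn] hs.
have IH a a' : a && a' = b -> cmeet n (f \o cons a) (g \o cons a') s = 0.
  move=> ab; apply: (IHn _ _ (h \o cons b)) => // u v un vn huv.
  by apply: fgh; rewrite /= ?un ?vn//; rewrite -ab in huv.
by case: b IH {hs} => IH /=; rewrite !IH ?addr0.
Qed.

(** Induction on [n]. The first coordinate is [bent_product_ge]. For the later ones the induction
    hypothesis applies to each of the four pairs of faces, and superadditivity merges the three
    pairs whose meet starts with [false]. *)
Lemma cent_cmeet_ge (R : realType) n (f g : seq bool -> R) :
  (forall s, 0 <= f s) -> (forall s, 0 <= g s) ->
  7 / 10 * \sum_(i < n)
      (cmarg n g i * cent_at n f i + cmarg n f i * cent_at n g i)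
    <= cent n (cmeet n f g).
Proof.
elim: n f g => [|n IHn] f g f0 g0; first by rewrite /cent !big_ord0 mulr0.
have ff b : forall s, 0 <= (f \o cons b) s by move=> s; exact: f0.
have gg b : forall s, 0 <= (g \o cons b) s by move=> s; exact: g0.
have IH a b := IHn _ _ (ff a) (gg b).
have m0 a b s : 0 <= cmeet n (f \o cons a) (g \o cons b) s by exact: cmeet_ge0.
have S3 := cent_superadditive n
  (fun s => addr_ge0 (m0 true false s) (m0 false true s)) (m0 false false).
have S2 := cent_superadditive n (m0 true false) (m0 false true).
rewrite centS /=.
rewrite -[cmeet n.+1 f g \o cons true]/(
  cmeet n (f \o cons true) (g \o cons true)).
rewrite -[cmeet n.+1 f g \o cons false]/(fun s =>
  cmeet n (f \o cons true) (g \o cons false) s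
  + cmeet n (f \o cons false) (g \o cons true) s
  + cmeet n (f \o cons false) (g \o cons false) s).
rewrite !csumD !csum_cmeet1.
have c0 := fun b => csum_ge0 n (ff b); have d0 := fun b => csum_ge0 n (gg b).
have Hb := bent_product_ge (c0 true) (c0 false) (d0 true) (d0 false).
rewrite big_ord_recl /= mulrDr; apply: lerD; first exact: Hb.
apply: le_trans (lerD (lexx _) (le_trans (lerD S2 (lexx _)) S3)).
apply: le_trans (lerD (IH true true)
  (lerD (lerD (IH true false) (IH false true)) (IH false false))).
rewrite -!mulrDr -!big_split /= le_eqVlt; apply/orP; left; apply/eqP.
by congr (_ * _); apply: eq_bigr => i _; ring.
Qed.

(** The entropy of [P] is exactly [l + \sum c_i mu_i]. That of the meet is at most
    [l + \sum c_i mu_i^2], its cross-entropy against [P], since marginals multiply. Eliminating [l]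
    and inserting [cent_cmeet_ge] gives the claim. *)
Lemma entropy_balance (R : realType) n (P : seq bool -> R)
    (c : 'I_n -> R) (l : R) :
  (forall s, 0 <= P s) -> csum n P = 1 ->
  (forall s t, size s = n -> size t = n ->
     P (bitmeet s t) = 0 -> P s * P t = 0) ->
  (forall s, size s = n -> P s != 0 ->
     - ln (P s) = l + \sum_(i < n) (nth false s i)%:R * c i) ->
  \sum_(i < n) (c i * (cmarg n P i * (1 - cmarg n P i))
                - (1 - 7 / 5 * cmarg n P i) * cent_at n P i) <= 0.
Proof.
move=> P0 P1 Pmeet lnP; pose Q := cmeet n P P.
pose L s := l + \sum_(i < n) (nth false s i)%:R * c i.
have Q0 s : 0 <= Q s by exact: cmeet_ge0.
have Q1 : csum n Q = 1 by rewrite csum_cmeet1 P1 mulr1.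
have csumL (f : seq bool -> R) : csum n (fun s => L s * f s)
    = l * csum n f + \sum_(i < n) c i * cmarg n f i.
  transitivity (csum n (fun s =>
      l * f s + \sum_(i < n) c i * ((nth false s i)%:R * f s))).
    apply: eq_csum => s _; rewrite /L mulrDl mulr_suml; congr (_ + _).
    by apply: eq_bigr => i _; ring.
  rewrite csumD csumZ csum_sum; congr (_ + _).
  by apply: eq_bigr => i _; rewrite csumZ cmargE.
have eta1 : eta 1 = 0 :> R by rewrite /eta ln1 mulr0 oppr0.
have entP : cent n P = l + \sum_(i < n) c i * cmarg n P i.
  have := csum_eta n P; rewrite P1 eta1 add0r => <-.
  have := csumL P; rewrite P1 mulr1 => <-.
  apply: eq_csum => s sn.
  have [->|Ps] := eqVneq (P s) 0; first by rewrite eta0 mulr0.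
  by rewrite /L -lnP// /eta; ring.
have entQ : cent n Q <= l + \sum_(i < n) c i * cmarg n Q i.
  have := csum_eta n Q; rewrite Q1 eta1 add0r => <-.
  have := csumL Q; rewrite Q1 mulr1 => <-.
  (* [P] and [Q] have equal mass, so [P - Q] may be added under the sum and Gibbs' inequality
     applied pointwise. *)
  rewrite -[leRHS]addr0 -(subrr (csum n P)) {2}P1 -Q1 -mulN1r -csumZ -!csumD.
  apply: le_csum => s sn.
  have QP : P s = 0 -> Q s = 0 by apply: cmeet_eq0.
  have := gibbs_term (Q0 s) (P0 s) QP.
  have [Ps|Ps] := eqVneq (P s) 0; first by rewrite (QP Ps) Ps eta0; lra.
  by rewrite /L -lnP// /eta; lra.
have := cent_cmeet_ge n P0 P0; rewrite -/Q => QP.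
have := le_trans QP entQ.
rewrite -subr_le0; apply: le_trans.
have -> : l = cent n P - \sum_(i < n) c i * cmarg n P i by rewrite entP addrK.
rewrite /cent mulr_sumr -!sumrB -big_split -sumrB /=.
by apply: ler_sum => i _; rewrite cmarg_cmeet; lra.
Qed.

(** * Positivity of the balance at one coordinate *)

(** After exponentiation: [2^6 = 64 < 97 < (5 / 2)^5]. *)
Lemma ln2_lt_ln5half (R : realType) : 6 * ln 2 < 5 * ln (5 / 2) :> R.
Proof.
rewrite mulrC mulr_natr [ltRHS]mulrC mulr_natr -!lnXn//; try lra.
rewrite ltr_ln ?posrE ?exprn_gt0//; lra.
Qed.

(** The extreme case [mu = 1/2], [a = ln 2] gives [c / 4 - 3/10 ln 2], whence the threshold
    [6/5 ln 2] for [c]. *)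
Lemma coordinate_balance_gt0 (R : realType) (c mu a : R) :
  6 * ln 2 < 5 * c -> 1 / 2 < mu < 1 -> 0 <= a <= ln 2 ->
  0 < c * (mu * (1 - mu)) - (1 - 7 / 5 * mu) * a.
Proof.
move=> cln2 /andP[mu12 mu1] /andP[a0 a2].
have ln20 : 0 <= ln 2 :> R by exact: le_trans a2.
have mumu : 0 < mu * (1 - mu) by apply: mulr_gt0; lra.
have := mulr_gt0 mumu (_ : 0 < 5 * c - 6 * ln 2); rewrite subr_gt0 => /(_ cln2).
have [h|h] := lerP (1 - 7 / 5 * mu) 0.
  have := mulr_le0_ge0 h a0; have := mulr_ge0 (ltW mumu) ln20; lra.
(* At [c = 6/5 ln 2] and [a = ln 2] the balance equals [6/5 (mu - 1/2) (5/3 - mu) ln 2]. *)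
have : 0 <= (mu - 1 / 2) * (5 / 3 - mu) * ln 2.
  by rewrite mulr_ge0//; apply: mulr_ge0; lra.
have := ler_wpM2l (ltW h) a2; lra.
Qed.

(** * From bit sequences to families of sets *)

Definition support_set n (s : seq bool) : {set 'I_n} :=
  [set i : 'I_n | nth false s i].

Lemma support_set_meet n (s t : seq bool) : size s = n -> size t = n ->
  support_set n (bitmeet s t) = support_set n s :&: support_set n t.
Proof.
by move=> sn tn; apply/setP => i; rewrite !inE nth_meet ?sn ?tn.
Qed.

Lemma csum_tuple (R : realType) n (f : seq bool -> R) :
  csum n f = \sum_(t : n.-tuple bool) f t.
Proof.
elim: n f => [|n IHn] f /=.
  by rewrite (big_pred1 [tuple]) // => t; apply/esym/eqP; exact: tuple0.
rewrite !IHn (reindex (fun p : bool * n.-tuple bool => [tuple of p.1 :: p.2])) /=.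
  rewrite -(pair_bigA _ (fun b (t : n.-tuple bool) => f (b :: t))) /=.
  by rewrite big_bool.
exists (fun t => (thead t, [tuple of behead t])) => [[b t] _|t _] /=.
  by rewrite theadE; congr pair; exact: val_inj.
by rewrite [RHS]tuple_eta.
Qed.

Lemma csum_support_set (R : realType) n (phi : {set 'I_n} -> R) :
  csum n (fun s => phi (support_set n s)) = \sum_A phi A.
Proof.
rewrite csum_tuple (reindex (fun A : {set 'I_n} => [tuple i \in A | i < n])).
  apply: eq_bigr => A _; congr phi; apply/setP => i.
  by rewrite inE -(tnth_nth false) tnth_mktuple.
exists (fun t : n.-tuple bool => support_set n t) => [A _|t _].
  by apply/setP => i; rewrite inE -(tnth_nth false) tnth_mktuple.
by apply: eq_from_tnth => i; rewrite tnth_mktuple inE -(tnth_nth false).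
Qed.

Lemma ln_prod (R : realType) (I : finType) (D : {pred I}) (f : I -> R) :
  (forall i, 0 < f i) -> ln (\prod_(i in D) f i) = \sum_(i in D) ln (f i).
Proof.
move=> f0; suff [] : 0 < \prod_(i in D) f i
  /\ ln (\prod_(i in D) f i) = \sum_(i in D) ln (f i) by [].
apply: (big_ind2 (fun u v => 0 < u /\ ln u = v)) =>
  [|u u' v v' [u0 <-] [v0 <-]|i _].
- by rewrite ln1.
- by rewrite mulr_gt0// lnM ?posrE.
- by [].
Qed.

Lemma frequent_absence (R : realType) n (x : 'I_n -> R) (F : {set {set 'I_n}}) :
  (forall i, 0 < x i <= 2 / 5) -> intersection_closed F -> (2 <= #|F|)%N ->
  exists2 i, i \in \bigcup_(A in F) A &
    \sum_(A in F) \prod_(j in A) x j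
      <= 2 * \sum_(A in F | i \notin A) \prod_(j in A) x j.
Proof.
move=> x25 Fcap F2; set w := fun A : {set 'I_n} => \prod_(j in A) x j.
have x0 i : 0 < x i by case/andP: (x25 i).
have w0 A : 0 < w A by apply: prodr_gt0 => j _.
have /card_gt1P[A [B [AF BF AB]]] := F2.
pose Z := \sum_(A in F) w A.
have Z0 : 0 < Z.
  rewrite /Z (bigD1 A)//= ltr_pwDl// sumr_ge0// => C _; exact: ltW.
pose p A := if A \in F then w A / Z else 0.
have p0 C : 0 <= p C.
  by rewrite /p; case: ifP => // _; apply: divr_ge0; exact: ltW.
pose P s := p (support_set n s).
have p_sum (D : pred {set 'I_n}) :
    \sum_(C | D C) p C = (\sum_(C in F | D C) w C) / Z.
  by rewrite mulr_suml big_mkcondl.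
have p1 : \sum_C p C = 1.
  rewrite p_sum (eq_bigl (mem F)) => [|C]; last by rewrite andbT.
  by rewrite -/Z divff// gt_eqF.
have P1 : csum n P = 1 by rewrite csum_support_set.
have margP (i : 'I_n) : cmarg n P i = \sum_(C : {set 'I_n} | i \in C) p C.
  rewrite cmargE big_mkcond /= -csum_support_set; apply: eq_csum => s _.
  by rewrite inE; case: nth; rewrite ?mul1r ?mul0r.
have margPC (i : 'I_n) : 1 - cmarg n P i = \sum_(C : {set 'I_n} | i \notin C) p C.
  rewrite margP -p1 (bigID (fun C : {set 'I_n} => i \in C)) /=.
  by rewrite addrAC subrr add0r.
pose c i := - ln (x i).
have cln (i : 'I_n) : 6 * ln 2 < 5 * c i.
  have pos52 : 0 < 5 / 2 :> R by lra.
  apply: lt_le_trans (ln2_lt_ln5half R) _; rewrite ler_wpM2l// /c -lnV ?posrE//.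
  rewrite ler_ln ?posrE ?invr_gt0//; have /andP[_ xi] := x25 i.
  by rewrite -[5 / 2]invf_div lef_pV2 ?posrE//; lra.
have balance := @entropy_balance R n P c (ln Z) (fun s => p0 _) P1.
(* Either some [i] works, or by [noi] every occurring [i] has marginal above 1/2, which will
   contradict [balance]. *)
case: (pickP (fun i => (i \in \bigcup_(A in F) A)
    && (Z <= 2 * \sum_(A in F | i \notin A) w A))) => [j /andP[jU jZ]|noi].
  by exists j.
have term (i : 'I_n) : 0 <= c i * (cmarg n P i * (1 - cmarg n P i))
     - (1 - 7 / 5 * cmarg n P i) * cent_at n P i /\
   (0 < cmarg n P i < 1 -> 0 < c i * (cmarg n P i * (1 - cmarg n P i))
     - (1 - 7 / 5 * cmarg n P i) * cent_at n P i).
  have a0 := cent_at_ge0 n i (fun s => p0 (support_set n s)).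
  have ab := cent_at_le_bent n i (fun s => p0 (support_set n s)).
  have := cmarg_bounds n i (fun s => p0 (support_set n s)).
  rewrite -/P P1 in ab a0 * => /andP[m0 m1].
  have [iU|iU] := boolP (i \in \bigcup_(A in F) A); last first.
    have mi0 : cmarg n P i = 0.
      rewrite margP big1// => C iC; rewrite /p; case: ifPn => // CF.
      by case/bigcupP: iU; exists C.
    rewrite mi0 bent0l in ab *; rewrite ltxx; split=> //; lra.
  have mi12 : 1 / 2 < cmarg n P i.
    have := noi i; rewrite iU /= => /negbT; rewrite -ltNge.
    have -> : \sum_(A in F | i \notin A) w A = Z * (1 - cmarg n P i).
      by rewrite margPC p_sum mulrC divfK// gt_eqF.
    nra.
  have a2 : cent_at n P i <= ln 2.
    apply: le_trans ab _; apply: le_trans (bent_le_ln2 m0 _) _; first by lra.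
    by rewrite addrC subrK mul1r.
  have pos : cmarg n P i < 1 -> 0 < c i * (cmarg n P i * (1 - cmarg n P i))
     - (1 - 7 / 5 * cmarg n P i) * cent_at n P i.
    by move=> mi1; apply: coordinate_balance_gt0; rewrite ?mi12 ?a0.
  split; last by case/andP.
  (* At marginal 1 the balance is 2/5 of the conditional entropy, hence nonnegative. *)
  move: m1; rewrite le_eqVlt => /predU1P[->|/pos/ltW//].
  by rewrite subrr !mulr0; lra.
(* Two distinct members of [F] differ at some [i]; both have positive weight, so the balance is
   strict there. *)
have [i0 mi0] : exists i0 : 'I_n, 0 < cmarg n P i0 < 1.
  have sep C D (i : 'I_n) : C \in F -> D \in F -> i \in C -> i \notin D ->
      0 < cmarg n P i < 1.
    move=> CF DF iC iD; rewrite -[cmarg n P i < 1]subr_gt0 margPC margP.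
    rewrite (bigD1 C)//= [\sum_(_ | i \notin _) _](bigD1 D)//=.
    by rewrite !ltr_pwDl ?sumr_ge0// /p ?CF ?DF divr_gt0.
  move: AB; rewrite eqEsubset negb_and => /orP[] /subsetPn[i i1 i2];
  by exists i; exact: sep i1 i2.
have : 0 < \sum_(i < n) (c i * (cmarg n P i * (1 - cmarg n P i))
    - (1 - 7 / 5 * cmarg n P i) * cent_at n P i).
  rewrite (bigD1 i0)//= ltr_pwDl ?sumr_ge0//; first exact: (term i0).2.
  by move=> i _; exact: (term i).1.
(* The premises of [balance] remain: closure under intersection, and the log-weight formula with
   [l = ln Z]. *)
rewrite ltNge balance// => [s t sn tn|s sn].
  rewrite /P support_set_meet// /p.
  case: ifPn => [_ /eqP|]; first by rewrite gt_eqF// divr_gt0.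
  case: ifPn => [sF|_ _ _]; last by rewrite mul0r.
  case: ifPn => [tF|_ _ _]; last by rewrite mulr0.
  by rewrite Fcap.
rewrite /P /p; case: ifPn => [_ _|]; last by rewrite eqxx.
rewrite ln_div ?posrE// opprB; congr (_ + _); rewrite /w.
rewrite ln_prod// -sumrN big_mkcond; apply: eq_bigr => i _ /=.
by rewrite inE; case: nth; rewrite ?mul1r ?mul0r.
Qed.

(** * Transfer to an arbitrary real closed field *)

Lemma weight_ratr (R : rcfType) n (k m : 'I_n -> nat) (A : {set 'I_n}) :
  weight R k m A = ratr (\prod_(j in A) ((m j)%:R / (k j)%:R)).
Proof.
rewrite rmorph_prod; apply: eq_bigr => j _.
by rewrite fmorph_div /= !ratr_nat.
Qed.

(** Both sums are images of rationals under the order embedding [ratr]. *)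
Lemma le_weight_sums_transfer (R S : rcfType) n (k m : 'I_n -> nat)
    (D E : pred {set 'I_n}) :
  (\sum_(A | D A) weight R k m A <= 2 * \sum_(A | E A) weight R k m A)
    = (\sum_(A | D A) weight S k m A <= 2 * \sum_(A | E A) weight S k m A).
Proof.
pose w (A : {set 'I_n}) : rat := \prod_(j in A) ((m j)%:R / (k j)%:R).
suff ratrE (T : rcfType) :
  (\sum_(A | D A) weight T k m A <= 2 * \sum_(A | E A) weight T k m A)
    = (\sum_(A | D A) w A <= 2 * \sum_(A | E A) w A) by rewrite !ratrE.
rewrite -(ler_rat T) rmorphM !rmorph_sum /= ratr_nat.
by congr (_ <= 2 * _); apply: eq_bigr => A _; exact: weight_ratr.
Qed.

(** From [m^2 <= k]: if [m <= 2] then [5 m <= 10 <= 2 k], and if [m >= 3] then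
    [5 m <= 2 m^2 <= 2 k]. Equality holds at [k = 5], [m = 2]. *)
Lemma odds_le (R : rcfType) (k m : nat) : (5 <= k)%N ->
  m%:R <= Num.sqrt (k%:R : R) -> (5 * m <= 2 * k)%N.
Proof.
move=> k5 mk; have : (m * m <= k)%N.
  rewrite -(ler_nat R) natrM -[leRHS]sqr_sqrtr// expr2.
  by apply: ler_pM.
by case: m {mk} => [|[|[|m]]]; nia.
Qed.

Theorem theorem1p3 (R : rcfType) (n : nat) (n_ge1 : (1 <= n)%N)
    (k m : 'I_n -> nat)
    (k_ge5 : forall i : 'I_n, (5 <= k i)%N)
    (m_ge1 : forall i : 'I_n, (1 <= m i)%N)
    (m_le_sqrt : forall i : 'I_n, (m i)%:R <= Num.sqrt ((k i)%:R : R))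
    (F : {set {set 'I_n}})
    (F_closed : intersection_closed F)
    (F_card : (2 <= #|F|)%N) :
  exists2 i : 'I_n, i \in \bigcup_(A in F) A &
    (\sum_(A in F | i \notin A) weight R k m A)
      / (\sum_(A in F) weight R k m A) >= 1 / 2%:R.
Proof.
(* The ratios are taken in the concrete reals, where [ln] is available; the resulting inequality is
   then carried back to [R]. *)
pose x (i : 'I_n) : Rdefinitions.R := (m i)%:R / (k i)%:R.
have k0 i : (0 < k i)%N by apply: leq_trans (k_ge5 i).
have x25 i : 0 < x i <= 2 / 5.
  rewrite divr_gt0 ?ltr0n//= ler_pdivrMr ?ltr0n// mulrAC ler_pdivlMr ?ltr0n//.
  by rewrite -!natrM ler_nat mulnC; exact: odds_le (k_ge5 i) (m_le_sqrt i).
have [i iU] := frequent_absence x25 F_closed F_card; exists i => //.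
have : \sum_(A in F) weight R k m A
    <= 2 * \sum_(A in F | i \notin A) weight R k m A.
  by rewrite (le_weight_sums_transfer _ Rdefinitions.R).
have Z0 : 0 < \sum_(A in F) weight R k m A.
  have w0 (A : {set 'I_n}) : 0 < weight R k m A.
    by apply: prodr_gt0 => j _; rewrite divr_gt0 ?ltr0n.
  have /card_gt0P[A AF] := ltnW F_card.
  by rewrite (bigD1 A)//= ltr_pwDl ?sumr_ge0// => B _; exact: ltW.
by rewrite ler_pdivlMr//; lra.
Qed.
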